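(* For every positive even integer $m$, $$\liminf_{n \to \infty} \frac{g(n,m) - n}{\sqrt{n/m}} > \sqrt{2.444}.$$
   Context: Graphs are finite and undirected; loops and multiple edges are allowed, a loop being a cycle of length $1$ and a pair of parallel edges forming a cycle of length $2$. For a graph $G$ with $n$ vertices, let $c_i$ be the number of cycles of length $i$ in $G$ ($1 \le i \le n$). For nonnegative integers $a_1, \dots, a_n$, let $f(a_1, a_2, \dots, a_n)$ denote the maximum possible number of edges in a graph with $n$ vertices satisfying $c_i \leq a_i$ for all $1\le i\le n$. For positive integers $n, m$, define $g(n,m) = f(a_1, \dots, a_n)$ where $a_i = 1$ if $i/m$ is an integer and $a_i = 0$ otherwise. That is, $g(n,m)$ is the maximum number of edges in an $n$-vertex graph in which every cycle has length divisible by $m$ and no two distinct cycles have the same length. *)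

(* Defs.v *)
From mathcomp Require Import all_boot.

Set Implicit Arguments.
Unset Strict Implicit.
Unset Printing Implicit Defensive.

(* Multigraphs with vertex set 'I_n and edge set 'I_e: each edge is mapped to
   a pair of end vertices.  The order of the pair is irrelevant (see joins);
   a loop at x is an edge mapped to (x, x). *)
Definition multigraph (n e : nat) := {ffun 'I_e -> 'I_n * 'I_n}.

Definition joins (n e : nat) (G : multigraph n e) (k : 'I_e) (x y : 'I_n) :=
  (G k == (x, y)) || (G k == (y, x)).

(* A cycle is a subgraph, identified with its set C of edges, so that rotating
   or reversing the cyclic enumeration below gives the same cycle.  ordS is the
   successor modulo i; hence for i = 1 a cycle is a loop, and for i = 2 it is a
   pair of distinct parallel edges between two distinct vertices. *)
Definition is_cycle (n e : nat) (G : multigraph n e) (i : nat)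
    (C : {set 'I_e}) : bool :=
  [exists v : {ffun 'I_i -> 'I_n}, exists c : {ffun 'I_i -> 'I_e},
    [&& 0 < i, injectiveb v, injectiveb c,
        [forall j, joins G (c j) (v j) (v (ordS j))] &
        C == [set c j | j : 'I_i]]].

Definition num_cycles (n e : nat) (G : multigraph n e) (i : nat) : nat :=
  #|[set C : {set 'I_e} | is_cycle G i C]|.

(* The bounds a_1, ..., a_n are the values a 1, ..., a n; the other values of a
   play no role. *)
Definition admissible (n : nat) (a : nat -> nat) (e : nat) : bool :=
  [exists G : multigraph n e,
    [forall i : 'I_n, num_cycles G i.+1 <= a i.+1]].

Lemma admissible0 (n : nat) (a : nat -> nat) : exists e, admissible n a e.
Proof.
exists 0; apply/existsP.
exists [ffun k : 'I_0 => False_rect _ (notF (ltn_ord k))].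
apply/forallP => i; rewrite /num_cycles.
rewrite (_ : [set C | _] = set0) ?cards0 //.
apply/setP => C; rewrite !inE; apply/negbTE/negP.
by case/existsP => v /existsP[c _]; case: (c ord0).
Qed.

Lemma loop_is_cycle (n e : nat) (G : multigraph n e) (k : 'I_e) (x : 'I_n) :
  G k = (x, x) -> is_cycle G 1 [set k].
Proof.
move=> Gk; apply/existsP; exists [ffun=> x]; apply/existsP; exists [ffun=> k].
apply/and5P; split=> //.
- by apply/injectiveP => i j _; rewrite !ord1.
- by apply/injectiveP => i j _; rewrite !ord1.
- by apply/forallP => j; rewrite /joins !ffunE Gk eqxx.
- apply/eqP/setP => l; rewrite !inE; apply/eqP/imsetP => [->|[j _ ->]].
    by exists ord0; rewrite ?ffunE.
  by rewrite ffunE.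
Qed.

Lemma parallel_is_cycle (n e : nat) (G : multigraph n e) (k l : 'I_e)
    (x y : 'I_n) :
  x != y -> k != l -> G k = (x, y) -> G l = (x, y) -> is_cycle G 2 [set k; l].
Proof.
move=> xy kl Gk Gl.
apply/existsP; exists [ffun j : 'I_2 => if j == ord0 then x else y].
apply/existsP; exists [ffun j : 'I_2 => if j == ord0 then k else l].
have inj2 (T : eqType) (s t : T) : s != t ->
    injective [ffun j : 'I_2 => if j == ord0 then s else t].
  move=> /negPf st [[|[|//]] ?] [[|[|//]] ?]; rewrite !ffunE -!val_eqE /=.
  - by move=> _; apply/val_inj.
  - by move/eqP; rewrite st.
  - by move/eqP; rewrite eq_sym st.
  - by move=> _; apply/val_inj.
apply/and5P; split=> //.
- exact/injectiveP/inj2.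
- exact/injectiveP/inj2.
- apply/forallP => -[[|[|//]] ?]; rewrite /joins !ffunE -!val_eqE /=.
    by rewrite Gk eqxx.
  by rewrite Gl eqxx orbT.
- apply/eqP/setP => z; rewrite !inE; apply/orP/imsetP.
    by case=> /eqP->; [exists ord0 | exists (lift ord0 ord0)]; rewrite ?ffunE.
  by case=> j _ ->; rewrite ffunE; case: ifP; rewrite eqxx; [left | right].
Qed.

Lemma admissible_bound (n : nat) (a : nat -> nat) (e : nat) :
  admissible n a e -> e <= n * n * (a 1 + (a 2).+1).
Proof.
case/existsP => G /forallP HG.
rewrite -[leqLHS]card_ord -sum1_card (partition_big G xpredT) //=.
have -> : n * n = #|{: 'I_n * 'I_n}| by rewrite card_prod card_ord.
rewrite -sum_nat_const; apply: leq_sum => -[x y] _.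
rewrite sum1dep_card; set F := [set k | _].
have FE k : k \in F -> G k = (x, y) by rewrite inE => /eqP.
have n0 : 0 < n by apply: leq_ltn_trans (ltn_ord x).
have [xy|xy] := eqVneq x y.
  apply: leq_trans (leq_addr _ _); apply: leq_trans (HG (Ordinal n0)).
  rewrite -(card_imset F (@set1_inj _)); apply/subset_leq_card/subsetP => C.
  case/imsetP => k /FE Gk ->; rewrite inE.
  by apply: (@loop_is_cycle _ _ _ _ y); rewrite Gk xy.
apply: leq_trans (leq_addl _ _).
have [->|[k Fk]] := set_0Vmem F; first by rewrite cards0.
have n1 : 1 < n.
  rewrite ltnNge; apply: contra xy => n1; rewrite -val_eqE /=.
  have := leq_trans (ltn_ord x) n1; have := leq_trans (ltn_ord y) n1.
  by rewrite !ltnS !leqn0 => /eqP-> /eqP->.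
rewrite (cardsD1 k) Fk add1n ltnS; apply: leq_trans (HG (Ordinal n1)).
have inj : {in F :\ k &, injective (fun l => [set k; l])}.
  move=> l l'; rewrite !in_setD1 => /andP[lk _] _ /setP/(_ l).
  by rewrite !inE eqxx orbT (negPf lk) => /esym/eqP.
rewrite -(card_in_imset inj); apply/subset_leq_card/subsetP => C.
case/imsetP => l; rewrite in_setD1 => /andP[lk /FE Gl] ->; rewrite inE.
by apply: parallel_is_cycle xy _ (FE _ Fk) Gl; rewrite eq_sym.
Qed.

Definition f (n : nat) (a : nat -> nat) : nat :=
  ex_maxn (admissible0 n a) (@admissible_bound n a).

Definition g (n m : nat) : nat := f n (fun i => if m %| i then 1 else 0).

(* Main.v *)
Require Import Defs.
From mathcomp Require Import all_boot all_order all_algebra.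
From mathcomp Require Import all_classical all_reals all_analysis.
From mathcomp Require Import ring lra zify.

(** The lower bound comes from one explicit graph, a union of fans glued at a
    common vertex, the hub.  A fan with [k] spokes has cyclomatic number [k - 1], and
    its cycles correspond to the pairs of spokes [i < j]: the length is the sum of
    the two spokes and of the rim between them.  For a union of fans the excess of
    edges over vertices is the total cyclomatic number minus 1, so the aim is many
    spokes with few edges in total, all lengths being distinct multiples of [m].

    Take [m] as the unit of length and let [W = 3 * U].  Fans with two spokes
    (cycles) use the lengths from 2 to [2 * W], fans with three spokes (theta graphs)
    use up the lengths between [2 * W] and [3 * W] in threes, and a single fan with
    [W] spokes of lengths [(2 * W + 1 + i) / 2] and rim paths of length [W - 1/2] has
    the lengths [2 * W + 1 + i + W * (j - i)], all beyond [3 * W] and distinct because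
    [i] and [j - i] are digits in base [W].  Half-integral spokes and rim paths are
    possible because [m] is even.  The number of independent cycles is about
    [2 * W + 2 * W / 3 + W = 11 * W / 3] and the number of edges about
    [(2 + 5/4 + 5/4 + 1) * W ^ 2 = 11 * W ^ 2 / 2], both up to lower order; hence the
    ratio tends to the square root of [(11/3) ^ 2 / (11/2) = 22/9 = 2.444...], which
    exceeds [2.444] ([g_lower_bound], [g_excess]).

    That every cycle comes from a pair of spokes follows from degrees alone
    ([cycle_named_edges], [even_edge_set]): a cycle meets each vertex in 0 or 2 edges,
    so it contains spokes and rim paths entirely or not at all, its edges at the hub
    select two spokes, and parity at the branch vertices then determines the rim. *)

Set Implicit Arguments.
Unset Strict Implicit.
Unset Printing Implicit Defensive.

(** * Graphs with named vertices and edges *)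

Lemma ordS_neq n (j : 'I_n) : 1 < n -> ordS j != j.
Proof.
move=> n1; rewrite -val_eqE /=; apply/eqP.
have jn := ltn_ord j; case: (ltnP j.+1 n) => h; first by rewrite modn_small //; lia.
have -> : j.+1 = n by lia.
rewrite modnn; lia.
Qed.

(** Both sides count the common elements of the two sequences. *)
Lemma count_mem_sub (T : eqType) (s t : seq T) :
  uniq s -> uniq t -> count [in t] s = count [in s] t.
Proof.
move=> us ut; rewrite -!size_filter; apply/perm_size/uniq_perm;
  rewrite ?filter_uniq // => x.
by rewrite !mem_filter andbC.
Qed.

(** A graph whose vertices and edges carry arbitrary names, listed by
    [v0 :: Vs] and [Es]; the numbering needed for [multigraph] is the position
    in these lists. *)
Section NamedMultigraph.

Variables (TV TE : eqType) (v0 : TV) (e0 : TE) (Vs : seq TV) (Es : seq TE).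
Variables (src tgt : TE -> TV).
Hypothesis src_in : forall k, k \in Es -> src k \in v0 :: Vs.
Hypothesis tgt_in : forall k, k \in Es -> tgt k \in v0 :: Vs.
Hypothesis Es_uniq : uniq Es.
Hypothesis loopless : forall k, k \in Es -> src k != tgt k.

Definition named_multigraph : multigraph (size Vs).+1 (size Es) :=
  [ffun k : 'I_(size Es) =>
    (inord (index (src (nth e0 Es k)) (v0 :: Vs)),
     inord (index (tgt (nth e0 Es k)) (v0 :: Vs)))].

Definition incident (x : TV) (k : TE) := (src k == x) || (tgt k == x).

Let num (x : TV) : 'I_(size Vs).+1 := inord (index x (v0 :: Vs)).

Let num_inj : {in v0 :: Vs &, injective num}.
Proof.
move=> x y xV yV /(congr1 val); rewrite /= !inordK ?ltnS -?index_mem //.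
- by move/(congr1 (nth v0 (v0 :: Vs))); rewrite !nth_index.
- by move: yV; rewrite -index_mem /= ltnS.
- by move: xV; rewrite -index_mem /= ltnS.
Qed.

(** Each vertex meets either no edge or exactly two edges of a cycle: the vertex
    [v j] meets the [j]-th edge and its predecessor, which differ because without
    loops a cycle has length at least 2.  This local condition is what
    [even_edge_set] builds on. *)
Lemma cycle_named_edges i (C : {set 'I_(size Es)}) :
  is_cycle named_multigraph i C ->
  exists cs : seq TE,
    [/\ uniq cs, size cs = i, {subset cs <= Es},
        forall x, x \in v0 :: Vs ->
          count (incident x) cs = 0 \/ count (incident x) cs = 2 &
        C = [set k : 'I_(size Es) | nth e0 Es k \in cs]].
Proof.
case/existsP => v /existsP[c /and5P[i_gt0 /injectiveP v_inj /injectiveP c_inj]].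
move=> /forallP c_joins /eqP CE.
pose nm (k : 'I_(size Es)) := nth e0 Es k.
have nm_in k : nm k \in Es by apply: mem_nth.
have nm_inj : injective nm.
  by move=> k l /eqP; rewrite nth_uniq // => /eqP/val_inj.
have cs_uniq : uniq [seq nm (c j) | j <- enum 'I_i].
  by rewrite map_inj_uniq ?enum_uniq // => j l /nm_inj/c_inj.
exists [seq nm (c j) | j <- enum 'I_i]; split=> //.
- by rewrite size_map size_enum_ord.
- by move=> _ /mapP[j _ ->].
- move=> x xV.
  have incE j : incident x (nm (c j)) = (v j == num x) || (v (ordS j) == num x).
    have srcV := src_in (nm_in (c j)); have tgtV := tgt_in (nm_in (c j)).
    have nE y : y \in v0 :: Vs -> (y == x) = (num y == num x).
      by move=> yV; apply/eqP/eqP => [->|/(num_inj yV xV)].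
    rewrite /incident (nE _ srcV) (nE _ tgtV).
    move: (c_joins j); rewrite /joins ffunE -/(nm _) -/(num _) -/(num _).
    by case/orP => /eqP[-> ->] //; rewrite orbC.
  have i_gt1 : 1 < i.
    rewrite ltn_neqAle i_gt0 andbT; apply/eqP => i1.
    have j1 : ordS (Ordinal i_gt0) = Ordinal i_gt0.
      by apply: val_inj; rewrite /= -i1.
    have srcV := src_in (nm_in (c (Ordinal i_gt0))).
    have tgtV := tgt_in (nm_in (c (Ordinal i_gt0))).
    have := loopless (nm_in (c (Ordinal i_gt0))).
    move: (c_joins (Ordinal i_gt0)); rewrite /joins ffunE j1 orbb.
    rewrite -/(nm _) -/(num _) -/(num _) => /eqP[e1 e2] /eqP; apply.
    by apply: num_inj => //; rewrite e1 e2.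
  rewrite count_map (eq_count (a2 := fun j => (v j == num x) || (v (ordS j) == num x)));
    last by move=> j /=; rewrite incE.
  case: (pickP (fun j => v j == num x)) => [j /eqP jE|none]; last first.
    by left; rewrite (eq_count (a2 := pred0)) ?count_pred0 // => j; rewrite /= !none.
  right; rewrite (eq_count (a2 := [in [:: j; ord_pred j]])).
    rewrite count_mem_sub ?enum_uniq //=; first by rewrite !mem_enum.
    rewrite inE andbT; apply: contra_neq (ordS_neq (ord_pred j) i_gt1) => jp.
    by rewrite ord_predK.
  move=> l; rewrite !inE /= -jE !(inj_eq v_inj); congr orb.
  by rewrite -[in RHS](inj_eq (@ordS_inj i)) ord_predK.
- rewrite CE; apply/setP => k; rewrite inE; apply/imsetP/mapP => [[j _ ->]|[j _ /nm_inj ->]].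
    by exists j; rewrite ?mem_enum.
  by exists j.
Qed.

End NamedMultigraph.

(** * Rows of fans *)

(** A name [(rim, p, a)] is read as an edge or as a vertex.  As an edge it is
    the [a]-th edge of the [p]-th spoke ([rim = false], counted from the branch
    vertex towards the hub) or of the [p]-th rim path ([rim = true], counted from
    branch vertex [p] towards branch vertex [p.+1]).  As a vertex it is the vertex
    at distance [a] from branch vertex [p] along that path; the branch vertex
    itself is [(false, p, 0)], which leaves the names [(true, p, 0)] free. *)
Definition fan_name : eqType := (bool * nat * nat)%type.

Definition names (rim : bool) (ps : seq nat) (t : nat -> seq nat) : seq fan_name :=
  [seq (rim, p, a) | p <- ps, a <- t p].

Lemma mem_names rim ps t b p a :
  ((b, p, a) \in names rim ps t) = [&& b == rim, p \in ps & a \in t p].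
Proof.
apply/allpairsPdep/and3P => [[q [d [qN dl [-> -> ->]]]]|[/eqP-> pN ab]].
  by split.
by exists p, a.
Qed.

Lemma uniq_names rim ps t :
  uniq ps -> (forall p, uniq (t p)) -> uniq (names rim ps t).
Proof.
move=> ups ut; apply: allpairs_uniq_dep => // -[q d] [q' d'] _ _.
by case=> -> ->.
Qed.

Lemma size_names rim ps t : size (names rim ps t) = \sum_(p <- ps) size (t p).
Proof. by rewrite size_allpairs_dep sumnE big_map. Qed.

Lemma size_names_iota rim n t :
  size (names rim (iota 0 n) t) = \sum_(p < n) size (t p).
Proof. by rewrite size_names -(big_mkord xpredT (fun p => size (t p))) /index_iota subn0. Qed.

(** The graph has a hub and [N] branch vertices in a row.  The [p]-th spoke is a
    path of length [s p] from branch vertex [p] to the hub, and the [p]-th rim path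
    is a path of length [r p] between branch vertices [p] and [p.+1], absent when
    [r p = 0].  So the absent rim paths cut the row into fans that share the hub. *)
Section FanGraph.

Variables (N : nat) (s r : nat -> nat).
Hypothesis s_gt0 : forall p, p < N -> 0 < s p.
Hypothesis r_in : forall p, 0 < r p -> p.+1 < N.

(** A name that no other vertex uses. *)
Definition hub : fan_name := (true, 0, 0).

Definition spoke_names := names false (iota 0 N) (fun p => iota 0 (s p)).
Definition rim_names := names true (iota 0 N) (fun p => iota 0 (r p)).
Definition inner_rim_names := names true (iota 0 N) (fun p => iota 1 (r p).-1).

Definition fan_vertices := spoke_names ++ inner_rim_names.
Definition fan_edges := spoke_names ++ rim_names.

Definition fan_src (k : fan_name) : fan_name :=
  let: (rim, p, a) := k in
  if rim && (a == 0) then (false, p, 0) else k.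
Definition fan_tgt (k : fan_name) : fan_name :=
  let: (rim, p, a) := k in
  if rim then if a.+1 < r p then (true, p, a.+1) else (false, p.+1, 0)
  else if a.+1 < s p then (false, p, a.+1) else hub.

Lemma mem_fan_edges b p a :
  ((b, p, a) \in fan_edges) = (p < N) && (a < if b then r p else s p).
Proof.
rewrite mem_cat !mem_names !mem_iota.
by case: b => /=; rewrite ?leq0n ?add0n ?orbF.
Qed.

Lemma mem_fan_vertices b p a :
  ((b, p, a) \in hub :: fan_vertices) =
  ((b, p, a) == hub) || (p < N) && (if b then 0 < a < r p else a < s p).
Proof.
rewrite inE mem_cat !mem_names !mem_iota; congr orb.
by case: b => /=; rewrite ?leq0n ?add0n ?orbF //; lia.
Qed.

Lemma fan_edges_uniq : uniq fan_edges.
Proof.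
rewrite cat_uniq !uniq_names ?iota_uniq //=; try by move=> p; apply: iota_uniq.
by rewrite andbT; apply/hasPn => -[[b p] a]; rewrite !mem_names => /andP[/eqP->].
Qed.

Lemma fan_src_in k : k \in fan_edges -> fan_src k \in hub :: fan_vertices.
Proof.
case: k => [[b p] a]; rewrite mem_fan_edges /fan_src => /andP[pN].
have sp := s_gt0 pN.
by case: b => /= al; [case: eqP => a0|]; rewrite mem_fan_vertices;
  apply/orP; right => /=; lia.
Qed.

Lemma fan_tgt_in k : k \in fan_edges -> fan_tgt k \in hub :: fan_vertices.
Proof.
case: k => [[b p] a]; rewrite mem_fan_edges /fan_tgt => /andP[pN].
case: b => /= al; case: ifP => [h|h]; rewrite mem_fan_vertices ?eqxx //;
  apply/orP; right => /=; try lia.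
have p1 : p.+1 < N by apply: r_in; lia.
by rewrite p1 s_gt0.
Qed.

Lemma fan_loopless k : k \in fan_edges -> fan_src k != fan_tgt k.
Proof.
case: k => [[b p] a] _; rewrite /fan_src /fan_tgt.
by case: b => /=; repeat case: ifP => ?; rewrite /hub !xpair_eqE /=; lia.
Qed.

Definition fan_graph := named_multigraph hub hub fan_vertices fan_edges fan_src fan_tgt.

(** The last edge of rim path [p.-1] ends at branch vertex [p]; [p.-1] is a true
    predecessor only when [0 < p]. *)
Definition branch_edges p : seq fan_name :=
  (false, p, 0) ::
  (if 0 < r p then [:: (true, p, 0)] else [::])
  ++ (if (0 < p) && (0 < r p.-1) then [:: (true, p.-1, (r p.-1).-1)] else [::]).

Lemma incident_spoke p a k : a.+1 < s p -> k \in fan_edges ->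
  incident fan_src fan_tgt (false, p, a.+1) k = (k \in [:: (false, p, a); (false, p, a.+1)]).
Proof.
move=> ap; case: k => [[b q] d].
rewrite mem_fan_edges !inE /incident /fan_src /fan_tgt /hub => /andP[qN].
have [->|qp] := eqVneq q p; case: b => /= dl; repeat case: ifP => ?;
  rewrite !xpair_eqE /=; lia.
Qed.

Lemma incident_rim p a k : a.+1 < r p -> k \in fan_edges ->
  incident fan_src fan_tgt (true, p, a.+1) k = (k \in [:: (true, p, a); (true, p, a.+1)]).
Proof.
move=> ap; case: k => [[b q] d].
rewrite mem_fan_edges !inE /incident /fan_src /fan_tgt /hub => /andP[qN].
have [->|qp] := eqVneq q p; case: b => /= dl; repeat case: ifP => ?;
  rewrite !xpair_eqE /=; lia.
Qed.

Lemma incident_branch p k : p < N -> k \in fan_edges ->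
  incident fan_src fan_tgt (false, p, 0) k = (k \in branch_edges p).
Proof.
move=> pN; case: k => [[b q] d].
rewrite mem_fan_edges !inE mem_cat /incident /fan_src /fan_tgt /hub => /andP[qN].
have [->|qp] := eqVneq q p; [|have [->|qp'] := eqVneq p q.+1];
  case: b => /= dl; repeat case: ifP => ?; rewrite ?inE ?in_nil !xpair_eqE /=; lia.
Qed.

Lemma incident_hub k : k \in fan_edges ->
  incident fan_src fan_tgt hub k = (k \in names false (iota 0 N) (fun p => [:: (s p).-1])).
Proof.
case: k => [[b q] d].
rewrite mem_fan_edges mem_names mem_iota !inE /incident /fan_src /fan_tgt /hub => /andP[qN].
by have := s_gt0 qN; case: b => /= sq dl; repeat case: ifP => ?; rewrite !xpair_eqE /=; lia.
Qed.

(** The edge sets in which every vertex has degree 0 or 2.  They contain a whole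
    spoke or rim path as soon as they contain one of its edges, so they are
    described by the booleans [sg p] for spokes and [rh p] for rim paths. *)
Section EvenEdgeSet.

Variable cs : seq fan_name.
Hypothesis cs_uniq : uniq cs.
Hypothesis cs_sub : {subset cs <= fan_edges}.
Hypothesis cs_deg : forall x, x \in hub :: fan_vertices ->
  count (incident fan_src fan_tgt x) cs = 0 \/ count (incident fan_src fan_tgt x) cs = 2.

(** Membership in [cs] of the edges at [x], when these are listed by [I]. *)
Lemma count_incident x I : x \in hub :: fan_vertices -> uniq I ->
  (forall k, k \in fan_edges -> incident fan_src fan_tgt x k = (k \in I)) ->
  count [in cs] I = 0 \/ count [in cs] I = 2.
Proof.
move=> xV uI xI; rewrite -count_mem_sub //.
rewrite -(@eq_in_count _ (incident fan_src fan_tgt x)); first exact: cs_deg.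
by move=> k /cs_sub; exact: xI.
Qed.

Lemma spoke_const p a : p < N -> a < s p ->
  ((false, p, a) \in cs) = ((false, p, 0) \in cs).
Proof.
move=> pN; elim: a => [//|a IH] al; rewrite -IH; last by lia.
have xV : (false, p, a.+1) \in hub :: fan_vertices.
  by rewrite mem_fan_vertices pN al orbT.
have := count_incident xV _ (fun k => @incident_spoke p a k al).
rewrite /= inE !xpair_eqE /= => /(_ ltac:(lia)).
by case: (_ \in cs) (_ \in cs) => -[] // -[].
Qed.

Lemma rim_const p a : p < N -> a < r p ->
  ((true, p, a) \in cs) = ((true, p, 0) \in cs).
Proof.
move=> pN; elim: a => [//|a IH] al; rewrite -IH; last by lia.
have xV : (true, p, a.+1) \in hub :: fan_vertices.
  by rewrite mem_fan_vertices pN al orbT.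
have := count_incident xV _ (fun k => @incident_rim p a k al).
rewrite /= inE !xpair_eqE /= => /(_ ltac:(lia)).
by case: (_ \in cs) (_ \in cs) => -[] // -[].
Qed.

Let sg (p : nat) := (false, p, 0) \in cs.
Let rh (p : nat) := (true, p, 0) \in cs.

Lemma rim_r p : rh p -> (p < N) && (0 < r p).
Proof. by move/cs_sub; rewrite mem_fan_edges. Qed.

Lemma spoke_N p : sg p -> p < N.
Proof. by move/cs_sub; rewrite mem_fan_edges => /andP[]. Qed.

(** The degree at branch vertex [p] is even, so reading the row from left to
    right the choice of spokes dictates the choice of rim paths. *)
Lemma branch_parity p : p < N -> rh p = sg p (+) (0 < p) && rh p.-1.
Proof.
move=> pN; have xV : (false, p, 0) \in hub :: fan_vertices.
  by rewrite mem_fan_vertices pN s_gt0 ?orbT.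
have := count_incident xV _ (fun k => @incident_branch p k pN).
have rp : rh p = (0 < r p) && rh p by apply/idP/andP => [h|[]//]; case/andP: (rim_r h).
have rp1 : rh p.-1 = (0 < r p.-1) && rh p.-1 by apply/idP/andP => [h|[]//]; case/andP: (rim_r h).
rewrite {}rp {}rp1 /branch_edges.
case: (ltnP 0 (r p)) => h1; case: (ltnP 0 p) => h2; case: (ltnP 0 (r p.-1)) => h3 /=;
rewrite ?inE ?xpair_eqE /= => /(_ ltac:(lia)).
all: try (have -> : ((true, p.-1, (r p.-1).-1) \in cs) = rh p.-1 by (apply: rim_const; lia)).
all: rewrite -/(sg p) -/(rh p).
all: by case: (sg p); case: (rh p); case: (rh p.-1) => // -[].
Qed.

(** The degree of the hub is 0 or 2; if it were 0 then by [branch_parity] no rim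
    path would be used either. *)
Lemma two_spokes : cs != [::] -> exists p q,
  [/\ p < q, q < N & forall x, sg x = (x == p) || (x == q)].
Proof.
move=> cs0.
pose S := [seq p <- iota 0 N | sg p].
have xV : hub \in hub :: fan_vertices by rewrite inE eqxx.
have u : uniq (names false (iota 0 N) (fun p => [:: (s p).-1])).
  by rewrite uniq_names ?iota_uniq.
have degS := count_incident xV u incident_hub.
have sizeS : size S = 0 \/ size S = 2.
  have <- : count [in cs] (names false (iota 0 N) (fun p => [:: (s p).-1])) = size S; last by [].
  have -> : names false (iota 0 N) (fun p => [:: (s p).-1]) =
      [seq (false, p, (s p).-1) | p <- iota 0 N].
    by rewrite /names; elim: (iota 0 N) => //= p ps ->.
  rewrite count_map size_filter; apply: eq_in_count => p; rewrite mem_iota => /= pN.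
  by apply: spoke_const; [lia | have := @s_gt0 p; lia].
have SE x : sg x = (x \in S).
  rewrite mem_filter mem_iota /=; case: (boolP (sg x)) => //= /spoke_N; lia.
have : sorted ltn S.
  by apply: sorted_filter; [exact: ltn_trans | exact: iota_ltn_sorted].
case: S sizeS SE => [|p [|q [|? ?]]] [] // _ SE; last first.
  rewrite /= andbT => pq; exists p, q; split=> // [|x]; last by rewrite SE !inE.
  by apply: spoke_N; rewrite SE !inE eqxx orbT.
move=> _; have rhF x : rh x = false.
  elim: x => [|x IH]; apply: contraTF isT => h; case/andP: (rim_r h) => xN _;
    by move: h; rewrite branch_parity // SE ?IH.
have [[[b p] a] kcs] : exists k, k \in cs.
  by case: (cs) cs0 => // k cs' _; exists k; rewrite inE eqxx.
have := cs_sub kcs; rewrite mem_fan_edges => /andP[pN]; case: b kcs => kcs al.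
  by move: kcs; rewrite rim_const // -/(rh p) rhF.
by move: kcs; rewrite spoke_const // -/(sg p) SE.
Qed.

(** The cycle that leaves the hub by spoke [p], follows the rim to [q] and
    returns by spoke [q]. *)
Definition pair_edges p q :=
  names false [:: p; q] (fun x => iota 0 (s x)) ++
  names true (iota p (q - p)) (fun x => iota 0 (r x)).

(** With exactly the spokes [p < q] in use, [branch_parity] makes the rim paths
    in use exactly those from [p] to [q]; in particular none of them is absent,
    that is, [p] and [q] lie in the same fan. *)
Lemma even_edge_set : cs != [::] -> exists p q,
  [/\ p < q, q < N, forall x, p <= x < q -> 0 < r x & perm_eq cs (pair_edges p q)].
Proof.
move=> /two_spokes[p [q [pq qN sgE]]].
have rhE x : x < N -> rh x = (p <= x < q).
  elim: x => [|x IH] xN; rewrite branch_parity // sgE /= ?IH; lia.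
exists p, q; split=> //.
  move=> x xpq; suff : rh x by case/rim_r/andP.
  by rewrite rhE //; lia.
apply: uniq_perm => //.
  rewrite cat_uniq !uniq_names ?iota_uniq //=; try by move=> x; apply: iota_uniq.
    by rewrite andbT; apply/hasPn => -[[b x] a]; rewrite !mem_names => /andP[/eqP->].
  by rewrite inE andbT; lia.
move=> [[b x] a]; rewrite mem_cat !mem_names !mem_iota !inE.
apply/idP/idP => [kcs|].
  have := cs_sub kcs; rewrite mem_fan_edges => /andP[xN]; case: b kcs => kcs al /=.
    by move: kcs; rewrite rim_const // -/(rh x) rhE //; lia.
  by move: kcs; rewrite spoke_const // -/(sg x) sgE => ->; lia.
case: b => /=; rewrite ?orbF.
  by case/andP=> xpq al; rewrite rim_const -?/(rh x) ?rhE; lia.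
by case/andP => xpq al; rewrite spoke_const -?/(sg x) ?sgE //; case/orP: xpq => /eqP->; lia.
Qed.

End EvenEdgeSet.

Definition pair_length p q := s p + s q + \sum_(p <= x < q) r x.

Lemma size_pair_edges p q : size (pair_edges p q) = pair_length p q.
Proof.
rewrite size_cat !size_names /pair_length !big_cons big_nil !size_iota addn0.
by congr addn; apply: eq_bigr => x _; rewrite size_iota.
Qed.

Lemma fan_graph_cycle i (C : {set 'I_(size fan_edges)}) : 0 < i ->
  is_cycle fan_graph i C -> exists p q,
  [/\ p < q, q < N, forall x, p <= x < q -> 0 < r x, i = pair_length p q &
    C = [set k : 'I__ | nth hub fan_edges k \in pair_edges p q]].
Proof.
move=> i_gt0 /(cycle_named_edges fan_src_in fan_tgt_in fan_edges_uniq fan_loopless).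
case=> cs [ucs sizecs subcs degcs CE].
have cs0 : cs != [::] by rewrite -size_eq0 sizecs -lt0n.
have [p [q [pq qN rpq cspq]]] := even_edge_set ucs subcs degcs cs0.
exists p, q; split=> //; first by rewrite -size_pair_edges -(perm_size cspq).
by rewrite CE; apply/setP => k; rewrite !inE (perm_mem cspq).
Qed.

Lemma size_fan_edges : size fan_edges = \sum_(p < N) s p + \sum_(p < N) r p.
Proof.
rewrite size_cat !size_names_iota.
by congr addn; apply: eq_bigr => x _; rewrite size_iota.
Qed.

(** Without the hub and the first edge of each present rim path vertices
    and edges have the same names; so each present rim path contributes one edge
    more than it contributes vertices. *)
Lemma size_fan_vertices :
  size fan_vertices + \sum_(p < N) (0 < r p : nat) = size fan_edges.
Proof.
rewrite size_fan_edges size_cat !size_names_iota -addnA; congr addn.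
  by apply: eq_bigr => x _; rewrite size_iota.
rewrite -big_split /=; apply: eq_bigr => x _; rewrite size_iota.
by case: (r x) => //= y; rewrite addn1.
Qed.

End FanGraph.

Lemma f_ge n a e (G : multigraph n e) :
  (forall i, i < n -> num_cycles G i.+1 <= a i.+1) -> e <= f n a.
Proof.
move=> h; rewrite /f; case: ex_maxnP => e' _; apply.
by apply/existsP; exists G; apply/forallP => i; apply: h.
Qed.

(** A row of fans in which distinct pairs of spokes of a common fan give distinct
    lengths has at most one cycle of each length. *)
Lemma g_ge_fans (N m n : nat) (s r : nat -> nat) :
  (forall p, p < N -> 0 < s p) -> (forall p, 0 < r p -> p.+1 < N) ->
  (forall p q, p < q -> q < N -> (forall x, p <= x < q -> 0 < r x) ->
    m %| pair_length s r p q) ->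
  (forall p q p' q', p < q -> q < N -> (forall x, p <= x < q -> 0 < r x) ->
    p' < q' -> q' < N -> (forall x, p' <= x < q' -> 0 < r x) ->
    pair_length s r p q = pair_length s r p' q' -> p = p' /\ q = q') ->
  n + \sum_(p < N) (0 < r p : nat) = (\sum_(p < N) s p + \sum_(p < N) r p).+1 ->
  \sum_(p < N) s p + \sum_(p < N) r p <= g n m.
Proof.
move=> s_gt0 r_in dvd inj; rewrite -size_fan_edges -size_fan_vertices -addSn => /addIn nE.
rewrite nE size_fan_vertices; apply: (f_ge (G := fan_graph N s r)) => i _.
rewrite /num_cycles; have cyc := fan_graph_cycle s_gt0 r_in (ltn0Sn i).
have [->|[C]] := set_0Vmem [set C | is_cycle (fan_graph N s r) i.+1 C]; first by rewrite cards0.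
rewrite inE => CC; have [p [q [pq qN rpq iE CE]]] := cyc C CC.
rewrite iE dvd // -iE; suff -> : [set C | is_cycle (fan_graph N s r) i.+1 C] = [set C] by rewrite cards1.
apply/setP => C'; rewrite !inE; apply/idP/eqP => [|->//].
move=> /cyc[p' [q' [pq' qN' rpq' iE' ->]]].
by have [-> ->] := inj p' q' p q pq' qN' rpq' pq qN rpq ltac:(congruence).
Qed.

(** * Choice of the spokes and rim paths *)

(** In units of [M] edges, where the cycles must have lengths divisible by
    [2 * M], the row consists of
    - [6 * U - 1] cycles, of lengths [2 * l] for [2 <= l <= 6 * U];
    - from [theta0], [U] theta graphs, the [t]-th one having the three lengths
      [2 * (6 * U + 1 + t)], [2 * (7 * U + 1 + t)] and [2 * (8 * U + 1 + t)], so that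
      [2 * l] occurs once for each [6 * U < l <= 9 * U];
    - from [fan0], one fan with [3 * U] spokes, in which spokes [i < j] give the
      length [2 * (6 * U + 1 + i + 3 * U * (j - i))];
    - at [pad0], a single spoke that lies on no cycle.

    The path lengths of the theta graphs and of the fan solve the linear equations
    for these cycle lengths; they need not be even, which is where the evenness of
    the modulus [2 * M] enters. *)
Definition theta0 U := 12 * U - 2.
Definition fan0 U := theta0 U + 3 * U.
Definition pad0 U := fan0 U + 3 * U.

Definition spoke_len U p :=
  if p < theta0 U then 1
  else if p < fan0 U then
    if (p - theta0 U) %% 3 == 1 then 5 * U + 1 + (p - theta0 U) %/ 3 else 1
  else 6 * U + 1 + (p - fan0 U).

Definition rim_len U p :=
  if p < theta0 U then if odd p then 0 else p + 2
  else if p < fan0 U then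
    if (p - theta0 U) %% 3 == 0 then 7 * U + (p - theta0 U) %/ 3
    else if (p - theta0 U) %% 3 == 1 then 9 * U + (p - theta0 U) %/ 3 else 0
  else if p.+1 < pad0 U then 6 * U - 1 else 0.

Ltac unfold_lens :=
  rewrite /spoke_len /rim_len /pad0 /fan0 /theta0; repeat case: ifP => ?; lia.

(** A single cycle is a fan with two spokes, of length 1, and one rim path; the
    shortest has length 4 because all three parts must be nonempty. *)
Lemma cycle_lens U l : 2 * l < theta0 U ->
  [/\ spoke_len U (2 * l) = 1, spoke_len U (2 * l).+1 = 1,
      rim_len U (2 * l) = 2 * l + 2 & rim_len U (2 * l).+1 = 0].
Proof. rewrite /theta0 => h; split; unfold_lens. Qed.

(** A theta graph is a fan with three spokes.  For cycle lengths [2 * x], [2 * y]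
    and [2 * z] its three paths have lengths [x + y - z], [x + z - y] and
    [y + z - x]; the first is the middle spoke, and each of the other two splits
    into an end spoke of length 1 and a rim path. *)
Lemma theta_lens U t : t < U ->
  let p := theta0 U + 3 * t in
  [/\ [/\ spoke_len U p = 1, spoke_len U p.+1 = 5 * U + 1 + t & spoke_len U p.+2 = 1],
      rim_len U p = 7 * U + t, rim_len U p.+1 = 9 * U + t & rim_len U p.+2 = 0].
Proof. by move=> tU p; rewrite /p; split; [split|..]; unfold_lens. Qed.

Lemma fan_lens U i : i < 3 * U ->
  spoke_len U (fan0 U + i) = 6 * U + 1 + i /\
  rim_len U (fan0 U + i) = if i.+1 < 3 * U then 6 * U - 1 else 0.
Proof. by move=> iU; split; unfold_lens. Qed.

Lemma rim_len_pad U p : 0 < rim_len U p -> p.+1 < pad0 U.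
Proof. unfold_lens. Qed.

(** The cycles of the row: single cycles, theta graphs (with [c] and [d] the
    positions of the two spokes among three) and the large fan. *)
Lemma pair_length_cases U p q : p < q -> (forall x, p <= x < q -> 0 < rim_len U x) ->
  let L := pair_length (spoke_len U) (rim_len U) p q in
  [\/ exists l, [/\ p = 2 * l, 2 * l < theta0 U, q = p.+1 & L = 2 * (l + 2)],
      exists t c d, [/\ t < U, p = theta0 U + 3 * t + c, q = theta0 U + 3 * t + d &
       [\/ [/\ c = 0, d = 1 & L = 2 * (6 * U + 1 + t)],
           [/\ c = 1, d = 2 & L = 2 * (7 * U + 1 + t)] |
           [/\ c = 0, d = 2 & L = 2 * (8 * U + 1 + t)]]] |
      exists i j, [/\ i < j, j < 3 * U, p = fan0 U + i, q = fan0 U + j &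
                      L = 2 * (6 * U + 1 + i + 3 * U * (j - i))]].
Proof.
move=> pq rpq L.
have qpad : q < pad0 U by have := @rim_len_pad U q.-1 (rpq _ _); lia.
have [pA|Ap] := ltnP p (theta0 U).
  have rp := rpq p; apply: Or31; exists p./2.
  have pE : p = 2 * p./2 by move: rp; rewrite /rim_len pA; case: ifP; lia.
  rewrite {}pE in pA pq rpq L rp *.
  have [s0 s1 r0 r1] := cycle_lens pA.
  have qE : q = (2 * p./2).+1.
    by apply/eqP; rewrite eqn_leq pq andbT leqNgt; apply/negP => h; have := rpq (2 * p./2).+1; rewrite r1; lia.
  rewrite mul2n doubleK -mul2n; split=> //.
  rewrite /L /pair_length qE big_nat1 s0 s1 r0; lia.
have [pB|Bp] := ltnP p (fan0 U).
  apply: Or32; exists ((p - theta0 U) %/ 3), ((p - theta0 U) %% 3).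
  have tU : (p - theta0 U) %/ 3 < U by move: pB; rewrite /fan0; lia.
  have pE : p = theta0 U + 3 * ((p - theta0 U) %/ 3) + (p - theta0 U) %% 3 by lia.
  move: tU pE (ltn_pmod (p - theta0 U) (isT : 0 < 3)).
  set t := _ %/ 3; set c := _ %% 3 => tU pE c3.
  have /= [[s0 s1 s2] r0 r1 r2] := theta_lens tU.
  set a := theta0 U + 3 * t in pE s0 s1 s2 r0 r1 r2 *.
  have q3 : q < a.+3.
    by rewrite ltnNge; apply/negP => h; have := rpq a.+2; rewrite r2; lia.
  have c2 : c <> 2 by move=> c2; have := rpq a.+2; rewrite r2; lia.
  exists (q - a); split=> //; first by lia.
  rewrite /L /pair_length pE.
  have [[-> ->]|[[-> ->]|[-> ->]]] :
    c = 0 /\ q = a.+1 \/ c = 1 /\ q = a.+2 \/ c = 0 /\ q = a.+2 by lia.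
  - by apply: Or31; rewrite addn0 big_nat1 s0 s1 r0; split; lia.
  - by apply: Or32; rewrite addn1 big_nat1 s1 s2 r1; split; lia.
  - apply: Or33; rewrite addn0 big_nat_recr //= big_nat1 s0 s2 r0 r1; split; lia.
apply: Or33; exists (p - fan0 U), (q - fan0 U).
move: qpad; rewrite /pad0 => qpad.
split; [lia..|].
have [sp _] := @fan_lens U (p - fan0 U) ltac:(lia).
have [sq _] := @fan_lens U (q - fan0 U) ltac:(lia).
rewrite subnKC // in sp; rewrite subnKC in sq; last by lia.
rewrite /L /pair_length sp sq.
have -> : \sum_(p <= x < q) rim_len U x = (q - p) * (6 * U - 1).
  rewrite -sum_nat_const_nat; apply: eq_big_nat => x xpq.
  have [_] := @fan_lens U (x - fan0 U) ltac:(lia).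
  by rewrite subnKC; last lia; case: ifP => // ; lia.
nia.
Qed.

(** The three kinds of fans use disjoint ranges of lengths: at most [12 * U], then
    up to [18 * U], then larger.  Within the large fan, [i] and [j - i] are the
    digits of the length in base [3 * U], since [i < 3 * U]. *)
Lemma pair_length_inj U p q p' q' :
  p < q -> (forall x, p <= x < q -> 0 < rim_len U x) ->
  p' < q' -> (forall x, p' <= x < q' -> 0 < rim_len U x) ->
  pair_length (spoke_len U) (rim_len U) p q =
    pair_length (spoke_len U) (rim_len U) p' q' -> p = p' /\ q = q'.
Proof.
move=> pq rpq pq' rpq'; have A : theta0 U = 12 * U - 2 by [].
have fan_ge i j : i < j -> 3 * U <= 3 * U * (j - i).
  by move=> ij; rewrite leq_pmulr // subn_gt0.
case: (pair_length_cases pq rpq) =>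
  [[l [-> lA -> ->]]|[t [c [d [tU -> -> tcd]]]]|[i [j [ij jU -> -> ->]]]];
case: (pair_length_cases pq' rpq') =>
  [[l' [-> lA' -> ->]]|[t' [c' [d' [tU' -> -> tcd']]]]|[i' [j' [ij' jU' -> -> ->]]]].
- by lia.
- by case: tcd' => -[? ? ->]; lia.
- by have := fan_ge _ _ ij'; lia.
- by case: tcd => -[? ? ->]; lia.
- by case: tcd => -[? ? ->]; case: tcd' => -[? ? ->]; lia.
- by have := fan_ge _ _ ij'; case: tcd => -[? ? ->]; lia.
- by have := fan_ge _ _ ij; lia.
- by have := fan_ge _ _ ij; case: tcd' => -[? ? ->]; lia.
move=> /eqP; rewrite eqn_pmul2l // -!addnA !eqn_add2l => /eqP E.
have U0 : 0 < 3 * U by lia.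
have ii : i = i'.
  have := congr1 (modn^~ (3 * U)) E.
  rewrite /= ![_ + 3 * U * _]addnC ![3 * U * _]mulnC !modnMDl !modn_small //; lia.
subst i'; move: E => /eqP; rewrite eqn_add2l eqn_pmul2l // => /eqP; lia.
Qed.

Lemma cycle_sums U l : 2 * l <= theta0 U ->
  \sum_(p < 2 * l) (spoke_len U p + rim_len U p) = l * l + 3 * l /\
  \sum_(p < 2 * l) (0 < rim_len U p) = l.
Proof.
elim: l => [|l IH] lA; first by rewrite !big_ord0.
have [IH1 IH2] := IH ltac:(lia).
have [s0 s1 r0 r1] := @cycle_lens U l ltac:(lia).
have -> : 2 * l.+1 = (2 * l).+2 by lia.
rewrite !big_ord_recr /= IH1 IH2 s0 s1 r0 r1; split; lia.
Qed.

Lemma theta_sums U t : t <= U ->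
  2 * \sum_(p < theta0 U + 3 * t) (spoke_len U p + rim_len U p) =
    2 * \sum_(p < theta0 U) (spoke_len U p + rim_len U p) + 42 * (U * t) + 3 * (t * t) + 3 * t /\
  \sum_(p < theta0 U + 3 * t) (0 < rim_len U p) =
    \sum_(p < theta0 U) (0 < rim_len U p) + 2 * t.
Proof.
elim: t => [|t IH] tU; first by rewrite !muln0 !addn0.
have [IH1 IH2] := IH ltac:(lia).
have [[s0 s1 s2] r0 r1 r2] := theta_lens tU.
have -> : theta0 U + 3 * t.+1 = (theta0 U + 3 * t).+3 by lia.
rewrite !big_ord_recr /= IH2 s0 s1 s2 r0 r1 r2.
(* With the sums generalized, only polynomial identities in [U] and [t] remain. *)
move: IH1; set X := \sum_(_ < _ + _) (_ + _); set Y := \sum_(_ < theta0 U) (spoke_len U _ + _).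
set Z := \sum_(_ < _) _; clear -tU; clearbody X Y Z; split; lia.
Qed.

Lemma fan_sums U i : i < 3 * U ->
  2 * \sum_(p < fan0 U + i) (spoke_len U p + rim_len U p) =
    2 * \sum_(p < fan0 U) (spoke_len U p + rim_len U p) + 24 * (U * i) + i * i - i /\
  \sum_(p < fan0 U + i) (0 < rim_len U p) =
    \sum_(p < fan0 U) (0 < rim_len U p) + i.
Proof.
elim: i => [|i IH] iU; first by rewrite !muln0 !addn0 subn0.
have [IH1 IH2] := IH ltac:(lia).
have [s0] := @fan_lens U i ltac:(lia); rewrite iU => r0.
rewrite addnS !big_ord_recr /= IH2 s0 r0.
move: IH1; set X := \sum_(_ < _ + _) (_ + _); set Y := \sum_(_ < fan0 U) (spoke_len U _ + _).
set Z := \sum_(_ < _) _; have ii : i <= i * i by case: (i) => // j; rewrite leq_pmulr.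
clear -iU ii; clearbody X Y Z; split; lia.
Qed.

(** The quadratic term 99 is the sum of 36 for the cycles, 21 + 3/2 for the theta
    graphs, 18 + 9/2 for the spokes and 18 for the rim of the fan; the number of rim
    paths is [(6 * U - 1) + 2 * U + (3 * U - 1)]. *)
Lemma total_sums U : 0 < U ->
  \sum_(p < pad0 U) (spoke_len U p + rim_len U p) = 99 * (U * U) - 1 /\
  \sum_(p < pad0 U) (0 < rim_len U p) = 11 * U - 2.
Proof.
move=> U0; have tE : theta0 U = 2 * (6 * U - 1) by rewrite /theta0; lia.
have [c1 c2] := @cycle_sums U (6 * U - 1) ltac:(lia); rewrite -tE in c1 c2.
have [t1 t2] := theta_sums (leqnn U); rewrite -/(fan0 U) in t1 t2.
have [f1 f2] := @fan_sums U (3 * U).-1 ltac:(lia).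
have [s0 r0] := @fan_lens U (3 * U).-1 ltac:(lia).
have -> : pad0 U = (fan0 U + (3 * U).-1).+1 by rewrite /pad0; lia.
rewrite prednK ?ltnn in r0; last by lia.
rewrite !big_ord_recr /= f2 s0 r0 t2 c2; split; last by lia.
rewrite {}t1 {}c1 in f1; move: f1; set X := \sum_(_ < _) _; clearbody X.
have [u uE] : exists u, U = u.+1 by case: (U) U0 => // u _; exists u.
(* All terms become polynomials in [u], without truncated subtraction. *)
rewrite uE; have -> : (3 * u.+1).-1 = 3 * u + 2 by lia.
have -> : 6 * u.+1 - 1 = 6 * u + 5 by lia.
clear; lia.
Qed.

(** The spoke of length [P] at the end of the row adds as many vertices as edges,
    which adjusts the number of vertices to [n] without changing the excess. *)
Lemma g_lower_bound U M n : 0 < U -> 0 < M -> 99 * (U * U) * M <= n ->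
  n + 11 * U - 3 <= g n (2 * M).
Proof.
move=> U0 M0 nU; have [sum_len sum_rim] := total_sums U0.
pose P := n + (11 * U - 2) - 1 - (99 * (U * U) - 1) * M.
have P0 : 0 < P by rewrite /P; nia.
pose s p := if p < pad0 U then M * spoke_len U p else P.
pose r p := M * rim_len U p.
have r_pos p : (0 < r p) = (0 < rim_len U p) by rewrite muln_gt0 M0.
have rN p : 0 < r p -> p.+1 < (pad0 U).+1 by rewrite r_pos => /rim_len_pad; lia.
have sums : \sum_(p < (pad0 U).+1) s p + \sum_(p < (pad0 U).+1) r p = M * (99 * (U * U) - 1) + P.
  have -> : \sum_(p < (pad0 U).+1) r p = \sum_(p < pad0 U) r p.
    rewrite big_ord_recr /=; have : ~~ (0 < r (pad0 U)); last by lia.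
    by apply/negP; rewrite r_pos => /rim_len_pad; lia.
  rewrite big_ord_recr /= {2}/s ltnn addnAC -sum_len big_distrr -big_split /=.
  by congr addn; apply: eq_bigr => p _; rewrite /s ltn_ord mulnDr.
have rims : \sum_(p < (pad0 U).+1) (0 < r p : nat) = 11 * U - 2.
  rewrite big_ord_recr /= -sum_rim r_pos.
  have -> : (0 < rim_len U (pad0 U)) = false by apply/negP => /rim_len_pad; lia.
  by rewrite addn0; apply: eq_bigr => p _; rewrite r_pos.
have pairE p q : p < q -> (forall x, p <= x < q -> 0 < r x) ->
    (forall x, p <= x < q -> 0 < rim_len U x) /\
    pair_length s r p q = M * pair_length (spoke_len U) (rim_len U) p q.
  move=> pq rpq; have rpq' x : p <= x < q -> 0 < rim_len U x by rewrite -r_pos; apply: rpq.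
  split=> //; have qN : q < pad0 U by have := @rim_len_pad U q.-1 (rpq' _ _); lia.
  rewrite /pair_length /s qN (ltn_trans pq qN) !mulnDr big_distrr /=.
  by congr addn.
have := @g_ge_fans (pad0 U).+1 (2 * M) n s r; rewrite rims sums.
have -> : M * (99 * (U * U) - 1) + P = n + 11 * U - 3 by rewrite /P; nia.
apply.
- by move=> p pN; rewrite /s; case: ifP => // pN'; rewrite muln_gt0 M0 /spoke_len; repeat case: ifP => // _; lia.
- exact: rN.
- move=> p q pq _ rpq; have [rpq' ->] := pairE p q pq rpq.
  rewrite mulnC; apply: dvdn_mul => //.
  by case: (pair_length_cases pq rpq') => [[l [_ _ _ ->]]|[t [c [d [_ _ _]]]]|[i [j [_ _ _ _ ->]]]];
   rewrite ?dvdn_mulr //; case=> -[_ _ ->]; rewrite dvdn_mulr.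
- move=> p q p' q' pq _ rpq pq' _ rpq'.
  have [h1 ->] := pairE p q pq rpq; have [h2 ->] := pairE p' q' pq' rpq'.
  by move/eqP; rewrite eqn_pmul2l // => /eqP; apply: pair_length_inj.
- nia.
Qed.

(** * The limit inferior *)

Import Order.TTheory GRing.Theory Num.Theory.
Local Open Scope ring_scope.

Lemma limn_einf_ge (R : realType) (u : nat -> \bar R) (c : \bar R) (n0 : nat) :
  (forall n, (n0 <= n)%N -> (c <= u n)%E) -> (c <= limn_einf u)%E.
Proof.
move=> h; rewrite limn_einf_lim (cvg_lim _ (@cvg_einfs_sup R u)) //.
apply: (@le_trans _ _ (einfs u n0)); last by apply: ereal_sup_ubound; exists n0.
by apply: le_ereal_inf_tmp => _ [p /= pn <-]; apply: h.
Qed.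

(** [U] is the integral part of [28 / 197 * y] with [y = sqrt (n / (2 * M))].  The fraction
    28 / 197 is a little below sqrt (2 / 99), so that [99 * U ^ 2 * M <= n], and
    11 * 28 / 197 is a little above 111 / 71, which absorbs the rounding and the
    constant 3 once [y] is large. *)
Lemma g_excess (R : realType) (M n : nat) : (0 < M)%N ->
  (10 ^+ 6 : R) <= Num.sqrt (n%:R / (2 * M)%:R) ->
  111 / 71 * Num.sqrt (n%:R / (2 * M)%:R : R) <= (g n (2 * M))%:R - n%:R.
Proof.
move=> M0; set x : R := n%:R / _; set y := Num.sqrt x => y_ge.
have M0R : 0 < M%:R :> R by rewrite ltr0n.
have x0 : 0 <= x by rewrite divr_ge0 ?ler0n.
have yx : y ^+ 2 = x by rewrite sqr_sqrtr.
have nE : n%:R = 2 * M%:R * y ^+ 2 :> R.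
  by rewrite yx /x natrM; field; rewrite gt_eqF.
have qy0 : 0 <= 28 / 197 * y by lra.
have /andP[Ule ltU] := truncn_itv qy0.
set U := Num.truncn _ in Ule ltU.
have {}ltU : 28 / 197 * y < U%:R + 1 by rewrite natr1.
have U0 : (0 < U)%N by rewrite -(ltr0n R); lra.
have UU : U%:R ^+ 2 <= (28 / 197 * y) ^+ 2 by rewrite lerXn2r ?nnegrE ?ler0n.
have nU : (99 * (U * U) * M <= n)%N.
  rewrite -(ler_nat R) !natrM nE mulrCA mulrC [leRHS]mulrAC [leRHS]mulrC.
  have : 0 <= M%:R * (y ^+ 2) :> R by rewrite mulr_ge0 ?sqr_ge0 // ltW.
  have : M%:R * U%:R ^+ 2 <= M%:R * (28 / 197 * y) ^+ 2 by rewrite ler_pM2l.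
  nra.
have := g_lower_bound U0 M0 nU; rewrite -(ler_nat R).
have -> : (n + 11 * U - 3)%:R = n%:R + 11 * U%:R - 3 :> R.
  by rewrite natrB; [rewrite natrD natrM | lia].
lra.
Qed.

Theorem mainTheorem4 (R : realType) (m : nat) (m_gt0 : (0 < m)%N)
    (m_even : ~~ odd m) :
  ((Num.sqrt (2444 / 1000 : R))%:E <
   limn_einf (fun n : nat =>
     (((g n m)%:R - n%:R) / Num.sqrt (n%:R / m%:R : R))%:E))%E.
Proof.
have mE : m = (2 * m./2)%N by rewrite mul2n even_halfK.
have M0 : (0 < m./2)%N by lia.
(* 111 / 71 lies strictly between sqrt 2.444 and sqrt (22 / 9). *)
apply: (@lt_le_trans _ _ (111 / 71)%:E).
  rewrite lte_fin -[ltRHS]ger0_norm; last lra.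
  by rewrite -sqrtr_sqr ltr_sqrt; nra.
have m0 : 0 < m%:R :> R by rewrite ltr0n.
apply: (@limn_einf_ge _ _ _ (Num.truncn (m%:R * 10 ^+ 12 : R)).+1) => n.
rewrite -(ler_nat R) => ltn; rewrite lee_fin.
have : m%:R * 10 ^+ 12 <= n%:R :> R by apply: le_trans ltn; apply/ltW/truncnS_gt.
move=> nm; have y_ge : 10 ^+ 6 <= Num.sqrt (n%:R / m%:R : R).
  rewrite -[leLHS]ger0_norm ?exprn_ge0 // -sqrtr_sqr ler_sqrt ?divr_ge0 //.
  by rewrite ler_pdivlMr // mulrC -exprM.
rewrite ler_pdivlMr; last by apply: lt_le_trans y_ge; rewrite exprn_gt0.
by move: y_ge; rewrite mE; apply: g_excess.
Qed.
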